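(* Let $n$ be a positive integer. For $i\in\{1,\dots,n\}$, we have $$\frac{B_{n,i}(t)}{(1-t)^n}=\sum_{k\ge1}\Big((2k+1)^{n-i}(2k)^{i-1}\Big)t^k.$$ For $i\in\{\overline1,\dots,\overline n\}$, we have $$\frac{B_{n,i}(t)}{(1-t)^n}=\sum_{k\ge1}\Big((2k-1)^{n-|i|}(2k)^{|i|-1}\Big)t^k.$$
   Context: $\mathfrak{B}_n$ is the group of signed permutations: permutations $\pi$ of $\{\pm1,\dots,\pm n\}$ with $\pi(-i)=-\pi(i)$; write $\pi_i=\pi(i)$, $\pi_0=0$, and $\overline{k}=-k$. For $\pi\in\mathfrak{B}_n$, $\mathrm{des}_B(\pi)=|\{i\in\{0,1,\dots,n-1\}:\pi_i>\pi_{i+1}\}|$. For $k\in\{\pm1,\dots,\pm n\}$ let $\mathfrak{B}_{n,k}=\{\pi\in\mathfrak{B}_n:\pi_1=k\}$ and $B_{n,k}(t)=\sum_{\pi\in\mathfrak{B}_{n,k}}t^{\mathrm{des}_B(\pi)}$.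
   Formalization: In the first identity the sum is taken over k ≥ 0 instead of k ≥ 1 (with 0^0 = 1): as printed it fails for i = 1, e.g. n = i = 1, where B_{1,1}(t) = 1; for i ≥ 2 the added term is 0, so nothing changes. *)

(* Defs.v *)
(* MathComp world. *)
From HB Require Import structures.
From mathcomp Require Import all_boot all_order all_fingroup all_algebra.

Set Implicit Arguments.
Unset Strict Implicit.
Unset Printing Implicit Defensive.

Import Order.TTheory GRing.Theory Num.Theory.
Local Open Scope ring_scope.

(* The letter (j, b) stands for the integer (-1)^b (j + 1), so that
   letter n is a copy of {1, ..., n} together with {-1, ..., -n}. *)
Definition letter (n : nat) : finType := ('I_n * bool)%type.

Definition letter_val n (x : letter n) : int :=
  if x.2 then - (x.1.+1)%:Z else (x.1.+1)%:Z.

Definition letter_opp n (x : letter n) : letter n := (x.1, ~~ x.2).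

Lemma letter_val_opp n (x : letter n) :
  letter_val (letter_opp x) = - letter_val x.
Proof. by case: x => j []; rewrite /letter_val //= opprK. Qed.

Lemma letter_val_inj n : injective (@letter_val n).
Proof. by move=> [i []] [j []] // [] /val_inj ->. Qed.

Lemma letter_valP n (z : int) :
  reflect (exists x : letter n, letter_val x = z) (0 < `|z| <= n)%N.
Proof.
apply: (iffP idP) => [|[[j b] <-]]; last first.
  by case: b; rewrite /letter_val /= ltn_ord.
case: z => [[|m]|m] //= ltmn; first by exists (Ordinal ltmn, false).
by exists (Ordinal ltmn, true); rewrite /letter_val NegzE.
Qed.

Definition signed_perms (n : nat) : {set {perm letter n}} :=
  [set p : {perm letter n} |
    [forall x, p (letter_opp x) == letter_opp (p x)]].

Lemma signed_perms_group_set n : group_set (signed_perms n).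
Proof.
apply/group_setP; split=> [|p q].
  by rewrite inE; apply/forallP=> x; rewrite !perm1.
rewrite !inE => /forallP hp /forallP hq; apply/forallP=> x.
by rewrite !permM (eqP (hp x)) (eqP (hq _)).
Qed.
Canonical signed_perms_group n := Group (signed_perms_group_set n).

(* The integer p_i, with p_0 = 0; only 0 <= i <= n is meaningful
   (the value is 0 for i > n). *)
Definition entry n (p : {perm letter n}) (i : nat) : int :=
  if i is j.+1 then
    if insub j is Some o then letter_val (p ((o, false) : letter n)) else 0
  else 0.

Definition desB n (p : {perm letter n}) : nat :=
  #|[set i : 'I_n | entry p i > entry p i.+1]|.

Definition signed_perms_at (n : nat) (k : int) : {set {perm letter n}} :=
  [set p in signed_perms n | entry p 1 == k].

Definition Bpoly (n : nat) (k : int) : {poly int} :=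
  \sum_(p in signed_perms_at n k) 'X^(desB p).

(* Formal power series in t, given by their coefficient functions and
   compared with =1. *)
Definition fps (R : Type) : Type := nat -> R.

Section FormalPowerSeries.
Variable R : comUnitRingType.
Implicit Types (f g : fps R) (p : {poly R}).

Definition fps_of_poly p : fps R := fun k => p`_k.

Definition fps_mul f g : fps R :=
  fun k => \sum_(j < k.+1) f j * g (k - j)%N.

(* The first k coefficients of 1 / f, obtained by solving f * g = 1 degree
   by degree; relevant when f 0 is a unit of R. *)
Fixpoint fps_inv_seq f (k : nat) : seq R :=
  if k is m.+1 then
    let s := fps_inv_seq f m in
    rcons s ((f 0%N)^-1 * ((m == 0%N)%:R - \sum_(j < m) f (m - j)%N * s`_j))
  else [::].

Definition fps_inv f : fps R := fun k => (fps_inv_seq f k.+1)`_k.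

Definition fps_div f g : fps R := fps_mul f (fps_inv g).

(* \sum_(k >= m) (c k) t^k.  For a first entry i > 0 the sum must start at
   m = 0: the summand (2k+1)^(n-i) (2k)^(i-1) at k = 0 is 0 if i > 1, but is
   1 if i = 1 (with 0^0 = 1), accounting for the identity permutation. *)
Definition fps_sum_from (m : nat) (c : nat -> R) : fps R :=
  fun k => if (m <= k)%N then c k else 0.

Lemma size_fps_inv_seq f k : size (fps_inv_seq f k) = k.
Proof. by elim: k => //= k IHk; rewrite size_rcons IHk. Qed.

Lemma nth_fps_inv_seq f k j : (j < k)%N -> (fps_inv_seq f k)`_j = fps_inv f j.
Proof.
elim: k => // k IHk; rewrite ltnS leq_eqVlt => /predU1P[->//|ltjk].
by rewrite /= nth_rcons size_fps_inv_seq ltjk IHk.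
Qed.

Lemma fps_mulV f : f 0%N \is a GRing.unit ->
  fps_mul f (fps_inv f) =1 fps_of_poly 1.
Proof.
move=> Uf k; rewrite /fps_mul /fps_of_poly coef1.
rewrite big_ord_recl subn0 {1}/fps_inv /= nth_rcons size_fps_inv_seq ltnn eqxx.
rewrite mulVKr // -[RHS]addr0 -addrA; congr (_ + _).
apply/eqP; rewrite addrC subr_eq0; apply/eqP.
rewrite [RHS](reindex_inj rev_ord_inj) /=; apply: eq_bigr => i _.
rewrite nth_fps_inv_seq; first by rewrite subKn.
by rewrite subnS prednK ?subn_gt0 // leq_subr.
Qed.

End FormalPowerSeries.

(* Main.v *)
(* Deleting the first letter x of a signed permutation of size n+1 and
   standardizing gives a signed permutation of size n with first letter y, and
   the change in the number of descents depends only on x and y.  Hence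
   B_{n+1,x} = \sum_y t^{e(x,y)} B_{n,y} with e(x,y) in {0,1}.  The claimed
   series satisfy the same recurrence up to the factor 1 - t, because the sums
   over y are geometric sums in consecutive integers 2k, 2k+1 or 2k-1, 2k, so
   they telescope; the theorem follows by induction on n.  Identities of power
   series are proved for their truncations, modulo every power of t. *)
Require Import Defs.
From HB Require Import structures.
From mathcomp Require Import all_boot all_order all_fingroup all_algebra.
From mathcomp Require Import ring zify.

Set Implicit Arguments.
Unset Strict Implicit.
Unset Printing Implicit Defensive.

Import Order.TTheory GRing.Theory Num.Theory.
Local Open Scope ring_scope.

(** * Inserting a first letter into a signed permutation *)

(** Inverse of standardization: a gap is opened at absolute value [k.+1]. *)
Definition letter_lift n (k : 'I_n.+1) (y : letter n) : letter n.+1 :=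
  (lift k y.1, y.2).

Lemma letter_lift_inj n (k : 'I_n.+1) : injective (@letter_lift n k).
Proof. by move=> [i b] [j c] [] /(can_inj (bumpK _))/val_inj -> ->. Qed.

Lemma letter_liftP n (k : 'I_n.+1) (z : letter n.+1) :
  z.1 != k -> exists y, letter_lift k y = z.
Proof.
case: z => j b /=; rewrite eq_sym => /unlift_some[i -> _].
by exists (i, b).
Qed.

Lemma letter_lift_opp n (k : 'I_n.+1) (y : letter n) :
  letter_lift k (letter_opp y) = letter_opp (letter_lift k y).
Proof. by []. Qed.

Lemma ltr_letter_lift n (k : 'I_n.+1) (y z : letter n) :
  (letter_val (letter_lift k y) < letter_val (letter_lift k z)) =
  (letter_val y < letter_val z).
Proof.
case: y z => [i []] [j []]; rewrite /letter_val /= /bump; lia.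
Qed.

Definition letter0 n : letter n.+1 := (ord0, false).

Definition signed_cons_fun n (x : letter n.+1) (s : {perm letter n})
    (y : letter n.+1) : letter n.+1 :=
  if unlift ord0 y.1 is Some j then letter_lift x.1 (s (j, y.2))
  else (x.1, x.2 (+) y.2).

Lemma signed_cons_fun_inj n x s : injective (@signed_cons_fun n x s).
Proof.
move=> [i b] [j c]; rewrite /signed_cons_fun /=.
case: unliftP => [i'|] ->; case: unliftP => [j'|] -> //=.
- by move=> /letter_lift_inj/perm_inj[-> ->].
- by move=> [/eqP]; rewrite eq_sym (negPf (neq_lift _ _)).
- by move=> [/eqP]; rewrite (negPf (neq_lift _ _)).
- by move=> [/addbI ->].
Qed.

Definition signed_cons n x s : {perm letter n.+1} :=
  perm (@signed_cons_fun_inj n x s).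

Lemma signed_cons0 n x s : @signed_cons n x s (letter0 n) = x.
Proof.
by rewrite permE /signed_cons_fun unlift_none addbF -surjective_pairing.
Qed.

Lemma signed_cons_lift n x s y :
  @signed_cons n x s (letter_lift ord0 y) = letter_lift x.1 (s y).
Proof.
by rewrite permE /signed_cons_fun /= liftK -surjective_pairing.
Qed.

Lemma signed_cons_inj n x : injective (@signed_cons n x).
Proof.
move=> s r eq_sr; apply/permP => y; apply: (@letter_lift_inj _ x.1).
by rewrite -!signed_cons_lift eq_sr.
Qed.

Lemma signed_cons_opp n x s (y : letter n.+1) :
  s \in signed_perms n ->
  signed_cons x s (letter_opp y) = letter_opp (signed_cons x s y).
Proof.
rewrite inE => /forallP hs; rewrite !permE /signed_cons_fun /=.
case: unliftP => [j|] _; last by rewrite /letter_opp /= addbN.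
by rewrite -letter_lift_opp -(eqP (hs _)).
Qed.

(** A signed permutation sending 1 to [x] uses the absolute value of [x] only at positions 1 and -1,
    so its other values can be standardized. *)
Lemma signed_perms_cons n (x : letter n.+1) :
  [set p in signed_perms n.+1 | p (letter0 n) == x] =
  signed_cons x @: signed_perms n.
Proof.
apply/setP => p; rewrite inE; apply/andP/imsetP => [[hp /eqP p0]|[s hs ->]].
  have {}hp y : p (letter_opp y) = letter_opp (p y).
    by move: hp; rewrite inE => /forallP/(_ y)/eqP.
  have p0b b : p (ord0, b) = (x.1, x.2 (+) b).
    case: b; last by rewrite p0 addbF -surjective_pairing.
    by rewrite -[(_, _)]/(letter_opp (letter0 n)) hp p0 addbT.
  have ex y : exists z, letter_lift x.1 z = p (letter_lift ord0 y).
    apply: letter_liftP; apply/eqP => px.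
    (* Position 1 or -1 already takes this value, against injectivity. *)
    have: p (letter_lift ord0 y)
          = p (ord0, x.2 (+) (p (letter_lift ord0 y)).2).
      by rewrite p0b addKb -px -surjective_pairing.
    by move=> /perm_inj[].
  have [f fE] := fin_all_exists ex.
  have f_inj : injective f.
    by move=> y z eqf; apply/(@letter_lift_inj _ ord0)/(@perm_inj _ p);
       rewrite -!fE eqf.
  exists (perm f_inj).
    rewrite inE; apply/forallP => y; rewrite !permE; apply/eqP.
    by apply: (@letter_lift_inj _ x.1); rewrite letter_lift_opp !fE -hp.
  apply/permP => -[i b]; case: (unliftP ord0 i) => [j|] ->.
    rewrite -[(_, _)]/(letter_lift ord0 (j, b)) signed_cons_lift.
    by rewrite permE fE.
  by rewrite p0b permE /signed_cons_fun /= unlift_none.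
rewrite signed_cons0 eqxx; split=> //.
by rewrite inE; apply/forallP => y; rewrite signed_cons_opp.
Qed.

(** * Descents after insertion *)

Lemma entryS n (p : {perm letter n}) (i : 'I_n) :
  entry p i.+1 = letter_val (p (i, false)).
Proof. by rewrite /entry valK. Qed.

Lemma desBE n (p : {perm letter n}) :
  desB p = (\sum_(i < n) (entry p i.+1 < entry p i)%R)%N.
Proof. by rewrite /desB cardsE -sum1_card big_mkcond. Qed.

Lemma entry_cons n x s (i : 'I_n) :
  entry (signed_cons x s) i.+2 = letter_val (letter_lift x.1 (s (i, false))).
Proof. by rewrite -signed_cons_lift -entryS. Qed.

Lemma letter_val_lt0 n (x : letter n) : (letter_val x < 0) = x.2.
Proof. by case: x => j []; rewrite /letter_val //; lia. Qed.

(* The change in the number of descents caused by prepending [x] to a signed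
   permutation whose first letter is [y]. *)
Definition des_shift n (x : letter n.+2) (y : letter n.+1) : nat :=
  if x.2 then (y.2 ==> (x.1 <= y.1)%N)%N else (~~ y.2 && (y.1 < x.1)%N)%N.

Lemma desB_cons0 x s : desB (@signed_cons 0 x s) = x.2.
Proof.
by rewrite desBE big_ord1 (@entryS 1 _ ord0) signed_cons0 letter_val_lt0.
Qed.

(** Insertion replaces the comparison of 0 with the first entry of [s] by two: 0 with [x], and [x]
    with that entry lifted. Later comparisons survive the lift. *)
Lemma desB_cons n x s :
  desB (@signed_cons n.+1 x s) = (des_shift x (s (letter0 n)) + desB s)%N.
Proof.
rewrite !desBE big_ord_recl (@entryS _ _ ord0) signed_cons0 letter_val_lt0.
rewrite [in LHS]big_ord_recl [in RHS]big_ord_recl !addnA.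
congr (_ + _)%N; last first.
  apply: eq_bigr => i _; rewrite !lift0 (entry_cons x s (lift ord0 i)).
  rewrite (entry_cons x s (widen_ord (leqnSn n) i)) ltr_letter_lift.
  by rewrite (entryS s (lift ord0 i)) (entryS s (widen_ord (leqnSn n) i)).
rewrite lift0 (entry_cons x s ord0) (entryS (signed_cons x s) ord0).
rewrite signed_cons0.
rewrite (@entryS _ _ ord0) letter_val_lt0 /des_shift -/(letter0 n).
case: (s _) => j c; case: x => k b.
by case: b c => -[]; rewrite /letter_val /= /bump; lia.
Qed.

(** * Recurrence for the descent polynomials *)

Definition letter_Bpoly n (x : letter n.+1) : {poly int} :=
  \sum_(p in [set p in signed_perms n.+1 | p (letter0 n) == x]) 'X^(desB p).

Lemma Bpoly_letter n (x : letter n.+1) :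
  Bpoly n.+1 (letter_val x) = letter_Bpoly x.
Proof.
apply: eq_bigl => p; rewrite !inE (@entryS _ _ ord0).
by rewrite (inj_eq (@letter_val_inj _)).
Qed.

Lemma letter_Bpoly_cons n (x : letter n.+1) :
  letter_Bpoly x = \sum_(s in signed_perms n) 'X^(desB (signed_cons x s)).
Proof.
rewrite /letter_Bpoly signed_perms_cons big_imset //=.
by move=> s r _ _; apply: signed_cons_inj.
Qed.

Lemma letter_Bpoly1 (x : letter 1) : letter_Bpoly x = 'X^(x.2).
Proof.
rewrite letter_Bpoly_cons (big_pred1 1%g) ?desB_cons0 // => s.
have -> : s = 1%g by apply/permP => -[[]].
by rewrite group1 /= eqxx.
Qed.

Lemma letter_BpolyS n (x : letter n.+2) :
  letter_Bpoly x = \sum_y 'X^(des_shift x y) * letter_Bpoly y.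
Proof.
rewrite letter_Bpoly_cons.
rewrite (partition_big (fun s : {perm letter n.+1} => s (letter0 n)) predT) //=.
apply: eq_bigr => y _; rewrite /letter_Bpoly mulr_sumr.
apply: eq_big => [s|s /andP[_ /eqP <-]]; first by rewrite !inE.
by rewrite desB_cons exprD.
Qed.

(** * Power series modulo powers of the variable *)

Definition eqmodX (R : nzRingType) N (p q : {poly R}) :=
  forall k, (k < N)%N -> p`_k = q`_k.

Lemma eqmodXM (R : comNzRingType) N (p q r : {poly R}) :
  eqmodX N p q -> eqmodX N (r * p) (r * q).
Proof.
move=> eq_pq k ltkN; rewrite !coefM; apply: eq_bigr => i _.
by rewrite eq_pq // (leq_ltn_trans _ ltkN) // leq_subr.
Qed.

Lemma fps_mul_poly (R : comUnitRingType) N (p q : {poly R}) (f g : fps R) :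
  (forall k, (k < N)%N -> p`_k = f k) -> (forall k, (k < N)%N -> q`_k = g k) ->
  forall k, (k < N)%N -> (p * q)`_k = fps_mul f g k.
Proof.
move=> pf qg k ltkN; rewrite coefM; apply: eq_bigr => -[i /= leik] _.
by rewrite pf ?qg // (leq_ltn_trans _ ltkN) // leq_subr.
Qed.

(** Truncation moves the computation into the polynomial ring: if [f] inverts [q], then p f = (q s)
    f = (q f) s = s modulo ['X^N]. *)
Lemma fps_div_eq (R : comUnitRingType) (p q : {poly R}) (s : fps R) :
  q`_0 \is a GRing.unit ->
  (forall N, eqmodX N (q * \poly_(i < N) s i) p) ->
  fps_div (fps_of_poly p) (fps_of_poly q) =1 s.
Proof.
move=> Uq eq_qs k; set N := k.+1; set f := fps_inv (fps_of_poly q).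
have cT (g : fps R) j : (j < N)%N -> (\poly_(i < N) g i)`_j = g j.
  by move=> ltj; rewrite coef_poly ltj.
rewrite /fps_div -/f.
rewrite -(fps_mul_poly (N := N) (p := p) (fun _ _ => erefl) (cT f)) //.
have qf : eqmodX N (q * \poly_(i < N) f i) 1.
  move=> j ltj; rewrite (fps_mul_poly (fun _ _ => erefl) (cT f)) //.
  exact: fps_mulV.
rewrite mulrC -(eqmodXM _ (eq_qs N)) // mulrCA mulrA mulrC.
by rewrite (eqmodXM _ qf) // mulr1 cT.
Qed.

(** * Recurrence for the claimed series *)

(** As [x.1] is the absolute value minus one, these are the exponents for size [n.+1]. *)
Definition Bseries n (x : letter n.+1) : fps int :=
  if x.2 then fps_sum_from 1
    (fun k => (2 * k%:Z - 1) ^+ (n - x.1) * (2 * k%:Z) ^+ x.1)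
  else fps_sum_from 0
    (fun k => (2 * k%:Z + 1) ^+ (n - x.1) * (2 * k%:Z) ^+ x.1).

(** Times [a - b], the term of index [i] is [a ^+ (n - i) * b ^+ i - a ^+ (n.-1 - i) * b ^+ i.+1],
    so the sum telescopes. *)
Lemma sum_geometric_lt (R : comNzRingType) (a b : R) n m : (m <= n)%N ->
  (a - b) * (\sum_(i < n | (i < m)%N) a ^+ (n.-1 - i) * b ^+ i) =
  a ^+ n - a ^+ (n - m) * b ^+ m.
Proof.
move=> lemn; rewrite -(big_ord_widen _ (fun i => a ^+ (n.-1 - i) * b ^+ i)) //.
rewrite mulr_sumr; elim: m lemn => [|m IH] ltmn.
  by rewrite big_ord0 subn0 mulr1 subrr.
rewrite big_ord_recr IH ?(ltnW ltmn) //=.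
have -> : (n - m = (n - m.+1).+1)%N by lia.
have -> : (n.-1 - m = n - m.+1)%N by lia.
rewrite !exprS; ring.
Qed.

Lemma sum_geometric_ge (R : comNzRingType) (a b : R) n m : (m <= n)%N ->
  (a - b) * (\sum_(i < n | (m <= i)%N) a ^+ (n.-1 - i) * b ^+ i) =
  a ^+ (n - m) * b ^+ m - b ^+ n.
Proof.
move=> lemn; have := sum_geometric_lt a b (leqnn n).
rewrite subnn mul1r (bigID (fun i : 'I_n => (i < m)%N)) /= mulrDr.
under eq_bigl => i do rewrite ltn_ord /=.
under [X in _ + _ * X]eq_bigl => i do rewrite ltn_ord -leqNgt /=.
by rewrite sum_geometric_lt // => /(canRL (addKr _)) ->; ring.
Qed.

(** Both sides are the coefficient of t^k in the sum of the series t^(P i) F_i, with [P i] read as 0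
    or 1. *)
Lemma sum_shift (I : finType) (R : nmodType) (P : pred I) (F : I -> fps R) k :
  \sum_i (if (k < P i)%N then 0 else F i (k - P i)%N) =
  \sum_(i | ~~ P i) F i k + (if k is j.+1 then \sum_(i | P i) F i j else 0).
Proof.
rewrite (bigID P) /= addrC; congr (_ + _).
  by apply: eq_bigr => i /negPf ->; rewrite subn0.
case: k => [|k]; first by apply: big1 => i ->.
by apply: eq_bigr => i ->; rewrite subn1.
Qed.

(** The right side is a coefficient of (1 - t) times the series of [x]. On the left, the letters of
    each sign are split where [des_shift] jumps; each piece telescopes and the extra endpoints
    cancel. *)
Lemma Bseries_sum n (x : letter n.+2) k :
  \sum_(y : letter n.+1)
    (if (k < des_shift x y)%N then 0 else Bseries y (k - des_shift x y)%N) =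
  Bseries x k - (if k is j.+1 then Bseries x j else 0).
Proof.
have bits (F : letter n.+1 -> int) :
    \sum_y F y = \sum_i F (i, true) + \sum_i F (i, false).
  rewrite -big_split /=.
  transitivity (\sum_(i < n.+1) \sum_b F (i, b)).
    by rewrite pair_bigA; apply: eq_bigr => -[].
  by apply: eq_bigr => i _; rewrite big_bool.
have pos (m : 'I_n.+2) l : Bseries (m, false) l =
    (2 * l%:Z + 1) ^+ (n.+1 - m) * (2 * l%:Z) ^+ m by [].
have neg0 (m : 'I_n.+2) : Bseries (m, true) 0 = 0 by [].
(* In degree [l.+1] the odd base is 2l+1, as for the positive series in degree [l]; hence the
   cancellation across signs. *)
have negS (m : 'I_n.+2) l : Bseries (m, true) l.+1 =
    (2 * l%:Z + 1) ^+ (n.+1 - m) * (2 * l.+1%:Z) ^+ m.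
  by rewrite /Bseries /fps_sum_from /=; congr (_ ^+ _ * _); lia.
have sum_pos_lt (m : 'I_n.+2) l :
    \sum_(i < n.+1 | (i < m)%N) Bseries (i, false) l =
    (2 * l%:Z + 1) ^+ n.+1 - (2 * l%:Z + 1) ^+ (n.+1 - m) * (2 * l%:Z) ^+ m.
  by rewrite -sum_geometric_lt ?leq_ord // addrC addKr mul1r.
have sum_pos_ge (m : 'I_n.+2) l :
    \sum_(i < n.+1 | ~~ (i < m)%N) Bseries (i, false) l =
    (2 * l%:Z + 1) ^+ (n.+1 - m) * (2 * l%:Z) ^+ m - (2 * l%:Z) ^+ n.+1.
  under eq_bigl => i do rewrite -leqNgt.
  by rewrite -sum_geometric_ge ?leq_ord // addrC addKr mul1r.
have sum_neg0 (P : pred 'I_n.+1) : \sum_(i | P i) Bseries (i, true) 0 = 0.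
  exact: big1.
have sum_neg (P : pred 'I_n.+1) l : \sum_(i | P i) Bseries (i, true) l.+1 =
    \sum_(i < n.+1 | P i) (2 * l%:Z + 1) ^+ (n.+1.-1 - i) * (2 * l.+1%:Z) ^+ i.
  apply: eq_bigr => i _; rewrite /Bseries /fps_sum_from /=.
  by congr (_ ^+ _ * _); lia.
(* The larger base now comes second, which flips the sign of the geometric sums. *)
have step l : 2 * l%:Z + 1 - 2 * l.+1%:Z = -1 by lia.
have sum_neg_lt (m : 'I_n.+2) l :
    \sum_(i < n.+1 | ~~ (m <= i)%N) Bseries (i, true) l.+1 =
    (2 * l%:Z + 1) ^+ (n.+1 - m) * (2 * l.+1%:Z) ^+ m - (2 * l%:Z + 1) ^+ n.+1.
  under eq_bigl => i do rewrite -ltnNge.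
  apply: oppr_inj; rewrite opprB -sum_geometric_lt ?leq_ord // step mulN1r.
  by rewrite sum_neg.
have sum_neg_ge (m : 'I_n.+2) l :
    \sum_(i < n.+1 | (m <= i)%N) Bseries (i, true) l.+1 =
    (2 * l.+1%:Z) ^+ n.+1 - (2 * l%:Z + 1) ^+ (n.+1 - m) * (2 * l.+1%:Z) ^+ m.
  apply: oppr_inj; rewrite opprB -sum_geometric_ge ?leq_ord // step mulN1r.
  by rewrite sum_neg.
have sum_pos l : \sum_(i < n.+1) Bseries (i, false) l =
    (2 * l%:Z + 1) ^+ n.+1 - (2 * l%:Z) ^+ n.+1.
  have := sum_pos_ge ord0 l; rewrite subn0 mulr1 => <-.
  exact: eq_bigl.
have sum_negT l : \sum_(i < n.+1) Bseries (i, true) l.+1 =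
    (2 * l.+1%:Z) ^+ n.+1 - (2 * l%:Z + 1) ^+ n.+1.
  have := sum_neg_ge ord0 l; rewrite subn0 mulr1 => <-.
  exact: eq_bigl.
case: x => m b; rewrite bits /des_shift /=; case: b.
  rewrite !(sum_shift _ (fun i => Bseries (i, _))) /= big_pred0_eq.
  (* Negative series start in degree 1, so a shift by one makes degree 1 special too. *)
  case: k => [|[|k]]; rewrite ?sum_neg0 ?neg0 // sum_pos sum_neg_lt negS.
    by rewrite mulr0 expr0n /=; ring.
  by rewrite sum_neg_ge negS; ring.
rewrite (sum_shift (fun _ => false) (fun i => Bseries (i, true))) /=.
rewrite (sum_shift _ (fun i => Bseries (i, false))) /=.
case: k => [|k]; rewrite sum_pos_ge pos.
  (* The power [0 ^+ m], equal to 1 at [m = 0], stands on both sides; only [0 ^+ n.+1] has to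
     vanish. *)
  by rewrite sum_neg0 mulr0 !expr0n /=; ring.
by rewrite sum_negT big_pred0_eq sum_pos_lt pos; ring.
Qed.

(** * Induction on the size and conclusion *)

Lemma coef_1subX_mul_poly N (s : fps int) k : (k < N)%N ->
  ((1 - 'X) * \poly_(i < N) s i)`_k = s k - (if k is j.+1 then s j else 0).
Proof.
move=> ltkN; rewrite mulrBl mul1r coefB coefXM !coef_poly ltkN.
by case: k ltkN => //= k /ltnW ->.
Qed.

Lemma letter_Bpoly_series n (x : letter n.+1) N :
  eqmodX N ((1 - 'X) ^+ n.+1 * \poly_(i < N) Bseries x i) (letter_Bpoly x).
Proof.
elim: n x => [|n IHn] x k ltkN.
  (* At size 1 the series are 1/(1 - t) and t/(1 - t). *)
  rewrite letter_Bpoly1 coef_1subX_mul_poly // coefXn.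
  case: x => i b; rewrite /Bseries ord1 /=.
  by case: b; case: k ltkN => [|[|k]] _; rewrite /fps_sum_from /= ?mulr1 ?subrr.
rewrite exprSr -mulrA letter_BpolyS.
(* One factor [1 - 'X] is spent on the recurrence; the others serve the induction hypothesis. *)
have -> : ((1 - 'X) ^+ n.+1 * ((1 - 'X) * \poly_(i < N) Bseries x i))`_k =
  ((1 - 'X) ^+ n.+1 *
   \sum_y 'X^(des_shift x y) * \poly_(i < N) Bseries y i)`_k.
  apply: (@eqmodXM _ N) => // j ltjN.
  rewrite coef_1subX_mul_poly // -Bseries_sum coef_sum.
  apply: eq_bigr => y _; rewrite coefXnM coef_poly.
  by rewrite (leq_ltn_trans (leq_subr _ _) ltjN).
rewrite mulr_sumr !coef_sum; apply: eq_bigr => y _.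
by rewrite mulrCA (eqmodXM _ (IHn y)).
Qed.

Lemma fps_div_Bpoly n (x : letter n.+1) :
  fps_div (fps_of_poly (Bpoly n.+1 (letter_val x)))
          (fps_of_poly ((1 - 'X) ^+ n.+1)) =1 Bseries x.
Proof.
rewrite Bpoly_letter; apply: fps_div_eq => [|N]; last first.
  exact: letter_Bpoly_series.
by rewrite -horner_coef0 horner_exp !hornerE expr1n unitr1.
Qed.

Unset Implicit Arguments.

Theorem theorem10 (n : nat) (Hn : (0 < n)%N) :
  (forall i : nat, (1 <= i <= n)%N ->
     fps_div (fps_of_poly (Bpoly n i%:Z)) (fps_of_poly ((1 - 'X) ^+ n))
     =1 fps_sum_from 0
          (fun k : nat =>
             (2 * k%:Z + 1) ^+ (n - i)%N * (2 * k%:Z) ^+ (i - 1)%N))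
  /\
  (forall i : int, - n%:Z <= i <= -1 ->
     fps_div (fps_of_poly (Bpoly n i)) (fps_of_poly ((1 - 'X) ^+ n))
     =1 fps_sum_from 1
          (fun k : nat =>
             (2 * k%:Z - 1) ^+ (n - `|i|)%N * (2 * k%:Z) ^+ (`|i| - 1)%N)).
Proof.
case: n Hn => // n _; split=> [[|i] //= lein | [//|i] lein] k.
  have lti : (i < n.+1)%N by lia.
  have -> : i.+1%:Z = letter_val ((Ordinal lti, false) : letter n.+1) by [].
  by rewrite fps_div_Bpoly subn1.
have lti : (i < n.+1)%N by lia.
(* [Negz i] is -(i+1), so [i] itself indexes the letter. *)
have -> : Negz i = letter_val ((Ordinal lti, true) : letter n.+1) by [].
by rewrite fps_div_Bpoly subn1.
Qed.
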